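(* For fixed $a$ and $\lambda \rightarrow \infty$ with $|\arg(\lambda)| \leq \frac{1}{2}\pi - \delta$ \[ L_{W}^{\pm}(a,\lambda) \sim\frac{W(a,0)}{\lambda}\sum_{ s=0}^{\infty} \frac{\alpha_{s}(a)}{\lambda^{2s}}\pm \frac{W'(a,0)}{\lambda^{2}}\sum_{ s=0}^{\infty} \frac{\beta_{s}(a)}{\lambda^{2s}}, \] where $\alpha_{0}(a)=\beta_{0}(a)=1$, $\alpha_{1}(a)=\beta_{1}(a)=a$, and for $ s=0,1,2,\ldots$ \[ \alpha_{s+2}=a\alpha_{s+1}-\tfrac{1}{2}(s+1)(2s+1)\alpha_{s},\qquad \beta_{s+2}=a\beta_{s+1}-\tfrac{1}{2}(s+1)(2s+3)\beta_{s}, \] and \[ W\left(a,0\right)=2^{-3/4}\left|\frac{\Gamma\left(\tfrac{1}{4}+\tfrac{1}{2}ia\right)}{\Gamma\left(\tfrac{3}{4}+\tfrac{1}{2}ia\right)}\right|^{1/2},\quad W'\left(a,0\right)=-2^{-1/4}\left|\frac{\Gamma\left(\tfrac{3}{4}+\tfrac{1}{2}ia\right)}{\Gamma\left(\tfrac{1}{4}+\tfrac{1}{2}ia\right)}\right|^{1/2}. \]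
   Context: $a$ is real; $W(a,\pm t)$ are the Weber parabolic cylinder functions (DLMF Sect. 12.14), solutions of $y''+(\tfrac14 t^2-a)y=0$. $L_{W}^{\pm}(a,\lambda)=\int_{0}^{\infty} e^{-\lambda t} W(a,\pm t)dt$ for $|\arg\lambda|\le\tfrac12\pi$. $\delta$ denotes an arbitrary small positive constant. *)

(* Defs.v *)
From Stdlib Require Import Reals.
From Coquelicot Require Import Coquelicot.
Open Scope R_scope.

(* Real and imaginary parts of Euler's integral
   Gamma(x + i y) = int_0^oo t^(x-1) e^(-t) (cos(y ln t) + i sin(y ln t)) dt,
   valid for x > 0 (we only use x = 1/4, 3/4). *)
Definition Gamma_re (x y : R) : R :=
  RInt_gen (fun t => Rpower t (x - 1) * exp (- t) * cos (y * ln t))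
           (at_right 0) (Rbar_locally p_infty).
Definition Gamma_im (x y : R) : R :=
  RInt_gen (fun t => Rpower t (x - 1) * exp (- t) * sin (y * ln t))
           (at_right 0) (Rbar_locally p_infty).
Definition Gamma_abs (x y : R) : R :=
  sqrt (Gamma_re x y ^ 2 + Gamma_im x y ^ 2).

Definition W0 (a : R) : R :=
  Rpower 2 (-3/4) * sqrt (Gamma_abs (1/4) (a/2) / Gamma_abs (3/4) (a/2)).
Definition W0' (a : R) : R :=
  - Rpower 2 (-1/4) * sqrt (Gamma_abs (3/4) (a/2) / Gamma_abs (1/4) (a/2)).

Definition is_Weber_W (a : R) (f : R -> R) : Prop :=
  (forall x, ex_derive f x) /\
  (forall x, is_derive (Derive f) x ((a - x ^ 2 / 4) * f x)) /\
  f 0 = W0 a /\ Derive f 0 = W0' a.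

Fixpoint rec2 (k a : R) (n : nat) : R * R :=
  match n with
  | O => (1, a)
  | S s => let (u0, u1) := rec2 k a s in
           (u1, a * u1 - / 2 * (INR s + 1) * (2 * INR s + k) * u0)
  end.
Definition alpha (a : R) (s : nat) : R := fst (rec2 1 a s).
Definition beta (a : R) (s : nat) : R := fst (rec2 3 a s).

Definition cexp_neg (lam : C) (t : R) : C :=
  (exp (- Re lam * t) * cos (Im lam * t), - (exp (- Re lam * t) * sin (Im lam * t))).

Definition is_Laplace (g : R -> R) (lam : C) (L : C) : Prop :=
  is_RInt_gen (fun t => Cmult (cexp_neg lam t) (RtoC (g t)))
              (at_point 0) (Rbar_locally p_infty) L.

(* |arg lam| <= pi/2 - delta, lam <> 0  (for delta > 0 this forces Re lam > 0,
   where arg lam = atan (Im lam / Re lam)) *)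
Definition in_sector (delta : R) (lam : C) : Prop :=
  0 < Re lam /\ Rabs (atan (Im lam / Re lam)) <= PI / 2 - delta.

Definition trunc_exp (a sg : R) (N : nat) (lam : C) : C :=
  Cplus
    (Cmult (Cdiv (RtoC (W0 a)) lam)
       (sum_n (fun s => Cdiv (RtoC (alpha a s)) (Cpow lam (2 * s))) N))
    (Cmult (Cdiv (RtoC (sg * W0' a)) (Cpow lam 2))
       (sum_n (fun s => Cdiv (RtoC (beta a s)) (Cpow lam (2 * s))) N)).

(* Main.v *)
(* Integrating by parts, the Laplace transforms L_n of the derivatives g^(n) satisfy
   lam L_n = g^(n)(0) + L_(n+1), so that the error after the terms g^(n)(0) / lam^(n+1),
   n <= 2N+1, is L_(2N+2) / lam^(2N+2).  Differentiating g'' = (a - t^2/4) g repeatedly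
   gives a recurrence for g^(n), which at t = 0 is the one defining alpha and beta.
   An energy estimate bounds g and g', hence by the recurrence every g^(n), by A e^(C t);
   thus |L_(2N+2)| <= 2A / (Re lam - C), and this is O(1/|lam|) because in the sector
   |lam| <= k Re lam. *)
Require Import Defs.
From Stdlib Require Import Reals Lra Lia.
From Coquelicot Require Import Coquelicot.
Open Scope R_scope.

(** * Improper integrals of exponentially dominated functions *)

Lemma RInt_increment_le (phi : R -> R) (B eps u v : R) :
  (forall t, continuous phi t) -> 0 < eps -> 0 <= B ->
  (forall t, 0 <= t -> Rabs (phi t) <= B * exp (- eps * t)) ->
  0 <= u <= v ->
  Rabs (RInt phi 0 v - RInt phi 0 u) <= B / eps * exp (- eps * u).
Proof.
intros Hc He HB Hb [Hu Huv].
assert (Hex : forall x y, ex_RInt phi x y).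
{ intros x y. apply (ex_RInt_continuous (V := R_CompleteNormedModule)). intros t _. apply Hc. }
assert (E : RInt phi 0 v - RInt phi 0 u = RInt phi u v).
{ rewrite <- (RInt_Chasles phi 0 u v) by apply Hex.
  unfold plus; simpl. ring. }
rewrite E.
assert (Hg : is_RInt (fun t => B * exp (- eps * t)) u v
   (minus (- B / eps * exp (- eps * v)) (- B / eps * exp (- eps * u)))).
{ apply (is_RInt_derive (fun t => - B / eps * exp (- eps * t))).
  - intros x _. auto_derive; [exact I | field; lra].
  - intros x _. apply (ex_derive_continuous (V := R_NormedModule)).
    auto_derive. exact I. }
eapply Rle_trans.
- apply (norm_RInt_le phi (fun t => B * exp (- eps * t)) u v (RInt phi u v) _ Huv);
    [ | apply (RInt_correct (V := R_CompleteNormedModule)), Hex | exact Hg].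
  intros x Hx. apply Hb. lra.
- unfold minus, plus, opp; simpl.
  assert (0 <= B / eps * exp (- eps * v)).
  { apply Rmult_le_pos; [ apply Rdiv_le_0_compat; lra | left; apply exp_pos]. }
  replace (- B / eps) with (- (B / eps)) by (field; lra). lra.
Qed.

(** Increments of the primitive beyond [M] are at most [B / eps * exp (- eps * M)], so Cauchy's
    criterion at infinity gives the limit; increments from 0 give its bound. *)
Lemma is_lim_RInt_dominated (phi : R -> R) (B eps : R) :
  (forall t, continuous phi t) -> 0 < eps -> 0 <= B ->
  (forall t, 0 <= t -> Rabs (phi t) <= B * exp (- eps * t)) ->
  exists l : R, is_lim (RInt phi 0) p_infty l /\ Rabs l <= B / eps.
Proof.
intros Hc He HB Hb.
assert (Hinc := fun u v => RInt_increment_le phi B eps u v Hc He HB Hb).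
assert (Hlim : exists l : R, filterlim (RInt phi 0) (Rbar_locally p_infty) (locally l)).
{ apply (proj1 (Hierarchy.filterlim_locally_cauchy (U := R_CompleteSpace) (RInt phi 0))).
  intros [d Hd]. simpl.
  (* With this [M], [d * (1 + eps * M) = d + B / eps]. As [1 + x <= exp x], the tail bound at [M]
     falls below [d] without any logarithm. *)
  set (M := B / (d * eps ^ 2)).
  assert (HM : 0 <= M).
  { unfold M. apply Rdiv_le_0_compat; [lra | ]. apply Rmult_lt_0_compat; [lra | apply pow_lt; lra]. }
  assert (Hsmall : B / eps * exp (- eps * M) < d).
  { replace (- eps * M) with (- (eps * M)) by ring. rewrite exp_Ropp.
    assert (H1 := exp_ineq1_le (eps * M)).
    assert (H0 := Rmult_le_pos _ _ (Rlt_le _ _ He) HM).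
    apply (Rmult_lt_reg_r (exp (eps * M))); [apply exp_pos | ].
    rewrite Rmult_assoc, Rinv_l by (apply Rgt_not_eq, exp_pos).
    apply Rlt_le_trans with (d * (1 + eps * M)); [ | apply Rmult_le_compat_l; lra].
    replace (d * (1 + eps * M)) with (d + B / eps) by (unfold M; field; lra). lra. }
  assert (Hlt : forall u v, M < u -> u <= v -> Rabs (RInt phi 0 v - RInt phi 0 u) < d).
  { intros u v Hu Huv. eapply Rle_lt_trans; [apply Hinc; lra | ].
    eapply Rle_lt_trans; [ | apply Hsmall].
    apply Rmult_le_compat_l; [apply Rdiv_le_0_compat; lra | ].
    left. apply exp_increasing. nra. }
  exists (fun t => M < t). split; [exists M; auto | ].
  intros u v Hu Hv. change (Rabs (RInt phi 0 v - RInt phi 0 u) < d).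
  destruct (Rle_lt_dec u v) as [H | H]; [apply Hlt; assumption | ].
  rewrite Rabs_minus_sym. apply Hlt; lra. }
destruct Hlim as [l Hl]. exists l. split; [exact Hl | ].
change (Rbar_le (Rabs l) (B / eps)).
apply (is_lim_le_loc (fun T => Rabs (RInt phi 0 T)) (fun _ => B / eps) p_infty (Rabs l) (B / eps)).
- exists 0. intros T HT.
  specialize (Hinc 0 T ltac:(lra)). rewrite RInt_point in Hinc.
  change (zero : R) with 0 in Hinc.
  rewrite Rmult_0_r, exp_0, Rminus_0_r, Rmult_1_r in Hinc. exact Hinc.
- apply (is_lim_Rabs (RInt phi 0) p_infty l Hl).
- apply is_lim_const.
Qed.

(** Complex integrals are taken in [C] as a product of two copies of [R], so the two components can
    be treated by real limits. The filter [at_point 0] pins the lower end of integration to 0. *)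
Lemma is_RInt_gen_pair_p_infty (phi psi : R -> R) (l m : R) :
  (forall t, continuous phi t) -> (forall t, continuous psi t) ->
  is_lim (RInt phi 0) p_infty l -> is_lim (RInt psi 0) p_infty m ->
  is_RInt_gen (V := prod_NormedModule R_AbsRing R_NormedModule R_NormedModule)
    (fun t => (phi t, psi t)) (at_point 0) (Rbar_locally p_infty) (l, m).
Proof.
intros Hphi Hpsi Hl Hm P [d Hd].
destruct (Hl _ (locally_ball (l : R_UniformSpace) d)) as [M1 H1].
destruct (Hm _ (locally_ball (m : R_UniformSpace) d)) as [M2 H2].
apply (Filter_prod _ _ _ (fun x => x = 0) (fun T => Rmax M1 M2 < T)).
- reflexivity.
- exists (Rmax M1 M2). auto.
- intros x T -> HT. exists (RInt phi 0 T, RInt psi 0 T). split.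
  + apply is_RInt_fct_extend_pair; apply (RInt_correct (V := R_CompleteNormedModule)), (ex_RInt_continuous (V := R_CompleteNormedModule));
      intros; auto.
  + apply Hd. split; [apply H1 | apply H2]; simpl;
    (eapply Rle_lt_trans; [ | apply HT]); [apply Rmax_l | apply Rmax_r].
Qed.

(** * Functions of at most exponential growth *)

(** The rate [C] is left existential so that the class is closed under products as well as sums; it
    then contains the polynomials and passes along the recurrence for the derivatives. *)
Definition exp_bounded (h : R -> R) : Prop :=
  exists A C : R, forall t, 0 <= t -> Rabs (h t) <= A * exp (C * t).

Lemma exp_bounded_uniform (A C A' C' t : R) :
  0 <= t -> A <= A' -> 0 <= A' -> C <= C' -> A * exp (C * t) <= A' * exp (C' * t).
Proof.
intros Ht HA HA' HC.
apply Rle_trans with (A' * exp (C * t)).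
- apply Rmult_le_compat_r; [left; apply exp_pos | exact HA].
- apply Rmult_le_compat_l; [exact HA' | ].
  destruct (Rle_lt_or_eq_dec (C * t) (C' * t)) as [H | ->]; [nra | | lra].
  left. apply exp_increasing, H.
Qed.

Lemma exp_bounded_ext (h k : R -> R) :
  (forall t, h t = k t) -> exp_bounded h -> exp_bounded k.
Proof.
intros E [A [C H]]. exists A, C. intros t Ht. rewrite <- E. auto.
Qed.

Lemma exp_bounded_const (c : R) : exp_bounded (fun _ => c).
Proof.
exists (Rabs c), 0. intros t Ht. rewrite Rmult_0_l, exp_0. lra.
Qed.

Lemma exp_bounded_id : exp_bounded (fun t => t).
Proof.
exists 1, 1. intros t Ht. rewrite Rabs_pos_eq by lra.
assert (H := exp_ineq1_le t). rewrite !Rmult_1_l. lra.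
Qed.

Lemma exp_bounded_plus (h k : R -> R) :
  exp_bounded h -> exp_bounded k -> exp_bounded (fun t => h t + k t).
Proof.
intros [A [C H]] [B [D K]].
exists (Rabs A + Rabs B), (Rmax C D). intros t Ht.
eapply Rle_trans; [apply Rabs_triang | ].
rewrite Rmult_plus_distr_r.
apply Rplus_le_compat.
- eapply Rle_trans; [apply H, Ht | ].
  apply exp_bounded_uniform; [exact Ht | apply Rle_abs | apply Rabs_pos | apply Rmax_l].
- eapply Rle_trans; [apply K, Ht | ].
  apply exp_bounded_uniform; [exact Ht | apply Rle_abs | apply Rabs_pos | apply Rmax_r].
Qed.

Lemma exp_bounded_mult (h k : R -> R) :
  exp_bounded h -> exp_bounded k -> exp_bounded (fun t => h t * k t).
Proof.
intros [A [C H]] [B [D K]].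
exists (A * B), (C + D). intros t Ht.
rewrite Rabs_mult, Rmult_plus_distr_r, exp_plus.
replace (A * B * (exp (C * t) * exp (D * t)))
  with ((A * exp (C * t)) * (B * exp (D * t))) by ring.
apply Rmult_le_compat; auto using Rabs_pos.
Qed.

(** Common constants let all the integrations by parts take place in one half-plane [Re lam > C]. *)
Lemma exp_bounded_family (D : nat -> R -> R) (M : nat) :
  (forall n, exp_bounded (D n)) ->
  exists A C : R, 0 <= A /\ forall n, (n <= M)%nat -> forall t, 0 <= t ->
    Rabs (D n t) <= A * exp (C * t).
Proof.
intros H. induction M as [|M [A [C [HA IH]]]].
- destruct (H O) as [A [C HO]]. exists (Rabs A), C. split; [apply Rabs_pos | ].
  intros n Hn t Ht. replace n with O by lia.
  eapply Rle_trans; [apply HO, Ht | ].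
  apply exp_bounded_uniform; [exact Ht | apply Rle_abs | apply Rabs_pos | lra].
- destruct (H (S M)) as [B [C' HS]]. exists (Rmax A B), (Rmax C C').
  assert (H0 : 0 <= Rmax A B) by (eapply Rle_trans; [apply HA | apply Rmax_l]).
  split; [exact H0 | ]. intros n Hn t Ht.
  destruct (Nat.eq_dec n (S M)) as [-> | Hne].
  + eapply Rle_trans; [apply HS, Ht | ].
    apply exp_bounded_uniform; auto using Rmax_r.
  + eapply Rle_trans; [apply IH; [lia | exact Ht] | ].
    apply exp_bounded_uniform; auto using Rmax_l.
Qed.

(** * Weber's equation: growth and higher derivatives *)

(** The initial values are left out, so that the reflected solution is covered too. *)
Definition Weber_eq (a : R) (g : R -> R) : Prop :=
  (forall x, ex_derive g x) /\
  (forall x, is_derive (Derive g) x ((a - x ^ 2 / 4) * g x)).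

(** The coefficient is even in [x] and [sg ^ 2 = 1]. Both signs are thus handled at once, and the
    sign survives only in the derivative at 0. *)
Lemma Weber_eq_reflect (a sg : R) (f : R -> R) :
  sg = 1 \/ sg = -1 -> Weber_eq a f ->
  Weber_eq a (fun t => f (sg * t)) /\
  Derive (fun t => f (sg * t)) 0 = sg * Derive f 0.
Proof.
intros Hs [H1 H2].
assert (D : forall x, is_derive (fun t => f (sg * t)) x (sg * Derive f (sg * x))).
{ intros x. apply (is_derive_comp f (fun t => sg * t)).
  - apply Derive_correct, H1.
  - auto_derive; [exact I | ring]. }
split; [split | ].
- intros x. eexists. apply D.
- intros x.
  apply (is_derive_ext (fun t => sg * Derive f (sg * t))).
  { intros t. symmetry. apply is_derive_unique, D. }
  replace ((a - x ^ 2 / 4) * f (sg * x))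
    with (sg * (sg * ((a - (sg * x) ^ 2 / 4) * f (sg * x))))
    by (destruct Hs as [-> | ->]; field).
  apply (is_derive_scal (fun t => Derive f (sg * t))).
  apply (is_derive_comp (Derive f) (fun t => sg * t)).
  + apply H2.
  + auto_derive; [exact I | ring].
- transitivity (sg * Derive f (sg * 0)); [exact (is_derive_unique _ _ _ (D 0)) | ].
  rewrite Rmult_0_r. reflexivity.
Qed.

(* The energy [E = g'^2 + (t^2/4 + 1) g^2] satisfies [E' <= C E]:
   the quadratic growth of the coefficient cancels in [E']. *)
Lemma Weber_eq_exp_bounded (a : R) (g : R -> R) :
  Weber_eq a g -> exp_bounded g /\ exp_bounded (Derive g).
Proof.
intros [H1 H2].
(* Here [E' = 2 (a + 1) g g' + (t / 2) g^2]. The summand [Rabs (a + 1)] absorbs the cross term, and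
   1 absorbs the other one because [t / 2 <= t^2 / 4 + 1]. *)
set (C := Rabs (a + 1) + 1).
set (E := fun t => Derive g t ^ 2 + (t ^ 2 / 4 + 1) * g t ^ 2).
(* Gronwall's argument: [F' <= 0], so [F t <= F 0] for [t >= 0]. *)
set (F := fun t => E t * exp (- C * t)).
set (dF := fun t => (2 * (a + 1) * g t * Derive g t + t / 2 * g t ^ 2 - C * E t)
                    * exp (- C * t)).
assert (HF : forall x, is_derive F x (dF x)).
{ intros x. unfold F, E, dF.
  auto_derive.
  - repeat split; auto. eexists. apply H2.
  - assert (E2 : Derive (fun x => Derive g x) x = (a - x ^ 2 / 4) * g x)
      by exact (is_derive_unique _ _ _ (H2 x)).
    rewrite E2. change (Derive (fun x => g x) x) with (Derive g x).
    unfold E. field. }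
assert (HdF : forall t, dF t <= 0).
{ intros t. unfold dF.
  assert (He := exp_pos (- C * t)).
  cut (2 * (a + 1) * g t * Derive g t + t / 2 * g t ^ 2 - C * E t <= 0); [nra | ].
  unfold C, E.
  assert (Hab : 2 * (a + 1) * g t * Derive g t
      <= Rabs (a + 1) * (g t ^ 2 + Derive g t ^ 2)).
  { unfold Rabs; destruct (Rcase_abs (a + 1)).
    - assert (0 <= (g t + Derive g t) ^ 2) by apply pow2_ge_0. nra.
    - assert (0 <= (g t - Derive g t) ^ 2) by apply pow2_ge_0. nra. }
  assert (Ht : t / 2 * g t ^ 2 <= (t ^ 2 / 4 + 1) * g t ^ 2).
  { apply Rmult_le_compat_r; [apply pow2_ge_0 | ].
    assert (0 <= (t / 2 - 1) ^ 2) by apply pow2_ge_0. nra. }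
  assert (H3 := Rabs_pos (a + 1)).
  assert (H4 := pow2_ge_0 (Derive g t)).
  assert (H5 := Rmult_le_pos _ _ (pow2_ge_0 t) (pow2_ge_0 (g t))).
  assert (H6 := Rmult_le_pos _ _ H3 H5).
  nra. }
assert (HE : forall t, 0 <= t -> E t <= E 0 * exp (C * t)).
{ intros t Ht.
  destruct (MVT_gen F 0 t dF) as [c [_ Hc]].
  - intros x _. apply HF.
  - intros x _. apply continuity_pt_filterlim.
    apply (ex_derive_continuous (V := R_NormedModule)). eexists. apply HF.
  - assert (Hle : F t <= F 0) by (specialize (HdF c); nra).
    unfold F in Hle. rewrite Rmult_0_r, exp_0, Rmult_1_r in Hle.
    replace (E t) with (E t * exp (- C * t) * exp (C * t)).
    + apply Rmult_le_compat_r; [left; apply exp_pos | exact Hle].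
    + rewrite Rmult_assoc, <- exp_plus.
      replace (- C * t + C * t) with 0 by ring. rewrite exp_0. ring. }
assert (Habs : forall x y, x ^ 2 <= y -> Rabs x <= y + 1).
{ intros x y Hxy. unfold Rabs; destruct (Rcase_abs x); nra. }
assert (Hfin : forall h : R -> R, (forall t, h t ^ 2 <= E t) -> exp_bounded h).
{ intros h Hh.
  (* From [|h| <= h^2 + 1 <= E 0 * exp (C t) + 1]; the last 1 is absorbed since [exp (C t) >= 1]. *)
  exists (E 0 + 1), C. intros t Ht.
  assert (Hx := exp_ineq1_le (C * t)).
  assert (0 <= C * t).
  { apply Rmult_le_pos; [ | exact Ht]. unfold C. assert (Hq := Rabs_pos (a + 1)). lra. }
  assert (Rabs (h t) <= E 0 * exp (C * t) + 1).
  { apply Habs. eapply Rle_trans; [apply Hh | apply HE, Ht]. }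
  lra. }
split; apply Hfin; intros t; unfold E;
  assert (H4 := pow2_ge_0 (Derive g t));
  assert (H5 := Rmult_le_pos _ _ (pow2_ge_0 t) (pow2_ge_0 (g t)));
  assert (H7 := pow2_ge_0 (g t)); nra.
Qed.

(* [n - 1] and [n - 2] are truncated, harmlessly: their coefficients then vanish. *)
Lemma Weber_eq_Derive_n (a : R) (g : R -> R) :
  Weber_eq a g -> forall n : nat,
  (forall x, Derive_n g (S (S n)) x =
     (a - x ^ 2 / 4) * Derive_n g n x - INR n * (x / 2) * Derive_n g (n - 1) x
     - INR n * (INR n - 1) / 4 * Derive_n g (n - 2) x) /\
  (forall k, (k <= S (S n))%nat -> forall x, ex_derive (Derive_n g k) x).
Proof.
intros [H1 H2].
(* Differentiating the recurrence at [n] gives at once the differentiability of the derivative of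
   order [n + 2] and the recurrence at [n + 1]; hence the joint induction. *)
assert (step : forall n,
  (forall x, Derive_n g (S (S n)) x =
     (a - x ^ 2 / 4) * Derive_n g n x - INR n * (x / 2) * Derive_n g (n - 1) x
     - INR n * (INR n - 1) / 4 * Derive_n g (n - 2) x) ->
  (forall k, (k <= S n)%nat -> forall x, ex_derive (Derive_n g k) x) ->
  forall x, is_derive (Derive_n g (S (S n))) x
    ((a - x ^ 2 / 4) * Derive_n g (S n) x - INR (S n) * (x / 2) * Derive_n g n x
     - INR (S n) * INR n / 4 * Derive_n g (n - 1) x)).
{ intros n Hr Hd x.
  apply (is_derive_ext (fun x => (a - x ^ 2 / 4) * Derive_n g n x
     - INR n * (x / 2) * Derive_n g (n - 1) x
     - INR n * (INR n - 1) / 4 * Derive_n g (n - 2) x)).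
  { intros t. symmetry. apply Hr. }
  assert (E1 : INR n * Derive_n g (S (n - 1)) x = INR n * Derive_n g n x).
  { destruct n as [|m]; [simpl; ring | ]. replace (S (S m - 1)) with (S m) by lia. reflexivity. }
  assert (E2 : INR n * (INR n - 1) * Derive_n g (S (n - 2)) x
             = INR n * (INR n - 1) * Derive_n g (n - 1) x).
  { destruct n as [|[|m]]; [simpl; ring | simpl; ring | ].
    replace (S (S (S m) - 2)) with (S (S m) - 1)%nat by lia. reflexivity. }
  assert (A0 := Derive_correct _ _ (Hd n ltac:(lia) x)).
  assert (A1 := Derive_correct _ _ (Hd (n - 1)%nat ltac:(lia) x)).
  assert (A2 := Derive_correct _ _ (Hd (n - 2)%nat ltac:(lia) x)).
  change (Derive (Derive_n g n) x) with (Derive_n g (S n) x) in A0.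
  change (Derive (Derive_n g (n - 1)) x) with (Derive_n g (S (n - 1)) x) in A1.
  change (Derive (Derive_n g (n - 2)) x) with (Derive_n g (S (n - 2)) x) in A2.
  auto_derive.
  - repeat split; eexists; eassumption.
  - change (Derive (fun x => Derive_n g n x) x) with (Derive_n g (S n) x).
    change (Derive (fun x => Derive_n g (n - 1) x) x) with (Derive_n g (S (n - 1)) x).
    change (Derive (fun x => Derive_n g (n - 2) x) x) with (Derive_n g (S (n - 2)) x).
    rewrite S_INR.
    transitivity ((a - x ^ 2 / 4) * Derive_n g (S n) x - x / 2 * Derive_n g n x
      - / 2 * (INR n * Derive_n g (n - 1) x)
      - x / 2 * (INR n * Derive_n g (S (n - 1)) x)
      - / 4 * (INR n * (INR n - 1) * Derive_n g (S (n - 2)) x)); [field | ].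
    rewrite E1, E2. field. }
induction n as [|n [IHr IHd]].
- assert (Hr : forall x, Derive_n g 2 x =
     (a - x ^ 2 / 4) * Derive_n g 0 x - INR 0 * (x / 2) * Derive_n g (0 - 1) x
     - INR 0 * (INR 0 - 1) / 4 * Derive_n g (0 - 2) x).
  { intros x. transitivity ((a - x ^ 2 / 4) * g x).
    - exact (is_derive_unique _ _ _ (H2 x)).
    - simpl. field. }
  assert (Hd : forall k, (k <= 1)%nat -> forall x, ex_derive (Derive_n g k) x).
  { intros [|[|k]] Hk x; [apply H1 | eexists; apply H2 | lia]. }
  split; [exact Hr | ].
  intros k Hk x. destruct (Nat.eq_dec k 2) as [-> | Hne]; [ | apply Hd; lia].
  eexists. apply (step O Hr Hd).
- assert (Hr : forall x, Derive_n g (S (S (S n))) x =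
     (a - x ^ 2 / 4) * Derive_n g (S n) x
     - INR (S n) * (x / 2) * Derive_n g (S n - 1) x
     - INR (S n) * (INR (S n) - 1) / 4 * Derive_n g (S n - 2) x).
  { intros x.
    transitivity ((a - x ^ 2 / 4) * Derive_n g (S n) x - INR (S n) * (x / 2) * Derive_n g n x
     - INR (S n) * INR n / 4 * Derive_n g (n - 1) x).
    - apply (is_derive_unique (Derive_n g (S (S n)))). apply step; [exact IHr | ].
      intros k Hk. apply IHd. lia.
    - replace (S n - 1)%nat with n by lia. replace (S n - 2)%nat with (n - 1)%nat by lia.
      rewrite S_INR. field. }
  split; [exact Hr | ].
  intros k Hk x. destruct (Nat.eq_dec k (S (S (S n)))) as [-> | Hne]; [ | apply IHd; lia].
  eexists. apply (step (S n) Hr). intros j Hj. apply IHd. lia.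
Qed.

Lemma Weber_eq_is_derive_n (a : R) (g : R -> R) (n : nat) (x : R) :
  Weber_eq a g -> is_derive (Derive_n g n) x (Derive_n g (S n) x).
Proof.
intros H. apply (Derive_correct (Derive_n g n)).
apply (proj2 (Weber_eq_Derive_n a g H n)). lia.
Qed.

(** Strong induction: the energy estimate covers orders 0 and 1, and the recurrence expresses each
    higher order through lower ones with coefficients polynomial in [x]. *)
Lemma Weber_eq_Derive_n_exp_bounded (a : R) (g : R -> R) (n : nat) :
  Weber_eq a g -> exp_bounded (Derive_n g n).
Proof.
intros H. induction n as [n IH] using (well_founded_induction Wf_nat.lt_wf).
destruct (Weber_eq_exp_bounded a g H) as [B0 B1].
destruct n as [|[|n]]; [exact B0 | exact B1 | ].
apply (exp_bounded_ext (fun x =>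
  ((a + (- / 4) * (x * x)) * Derive_n g n x
   + (- (INR n / 2)) * (x * Derive_n g (n - 1) x))
  + (- (INR n * (INR n - 1) / 4)) * Derive_n g (n - 2) x)).
- intros x. rewrite (proj1 (Weber_eq_Derive_n a g H n)). field.
- assert (K0 := IH n ltac:(lia)).
  assert (K1 := IH (n - 1)%nat ltac:(lia)).
  assert (K2 := IH (n - 2)%nat ltac:(lia)).
  repeat first [ apply exp_bounded_plus | assumption | apply exp_bounded_mult
               | apply exp_bounded_id | apply exp_bounded_const ].
Qed.

(** * Derivatives at 0 and the coefficients [alpha], [beta] *)

Lemma rec2_shift (k a : R) (n : nat) : snd (rec2 k a n) = fst (rec2 k a (S n)).
Proof. simpl. destruct (rec2 k a n). reflexivity. Qed.

Lemma fst_rec2_SS (k a : R) (n : nat) :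
  fst (rec2 k a (S (S n))) = a * fst (rec2 k a (S n))
    - / 2 * (INR n + 1) * (2 * INR n + k) * fst (rec2 k a n).
Proof. 
rewrite <- (rec2_shift k a n).
simpl. destruct (rec2 k a n). reflexivity.
Qed.

(** At 0 the middle term of the recurrence drops out, so even and odd orders decouple. The factor
    [m (m - 1) / 4] is [(n + 1) (2n + 1) / 2] for [m = 2n + 2] and [(n + 1) (2n + 3) / 2] for
    [m = 2n + 3], which explains [k = 1] and [k = 3] in [rec2]. *)
Lemma Weber_eq_Derive_n_0 (a : R) (g : R -> R) (n : nat) :
  Weber_eq a g ->
  Derive_n g (2 * n) 0 = alpha a n * g 0 /\
  Derive_n g (S (2 * n)) 0 = beta a n * Derive g 0.
Proof.
intros H.
assert (R2 : forall m, Derive_n g (S (S m)) 0 =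
  a * Derive_n g m 0 - INR m * (INR m - 1) / 4 * Derive_n g (m - 2) 0).
{ intros m. rewrite (proj1 (Weber_eq_Derive_n a g H m)). field. }
unfold alpha, beta.
(* The recurrence has two steps, so the induction carries two consecutive indices. *)
cut ((Derive_n g (2 * n) 0 = fst (rec2 1 a n) * g 0 /\
      Derive_n g (S (2 * n)) 0 = fst (rec2 3 a n) * Derive g 0) /\
     (Derive_n g (2 * S n) 0 = fst (rec2 1 a (S n)) * g 0 /\
      Derive_n g (S (2 * S n)) 0 = fst (rec2 3 a (S n)) * Derive g 0)); [tauto | ].
induction n as [|n [[IA IB] [JA JB]]].
- split; split.
  + simpl. ring.
  + simpl. change (Derive (fun x => g x) 0) with (Derive g 0). ring.
  + change (2 * 1)%nat with 2%nat. rewrite R2. simpl. field.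
  + change (S (2 * 1))%nat with 3%nat. rewrite R2. simpl.
    change (Derive (fun x => g x) 0) with (Derive g 0). field.
- split; [split; assumption | ]. rewrite !fst_rec2_SS. split.
  + replace (2 * S (S n))%nat with (S (S (2 * S n))) by lia.
    rewrite R2, JA. replace (2 * S n - 2)%nat with (2 * n)%nat by lia. rewrite IA.
    rewrite mult_INR, !S_INR. simpl (INR 0). field.
  + replace (S (2 * S (S n)))%nat with (S (S (S (2 * S n)))) by lia.
    rewrite R2, JB. replace (S (2 * S n) - 2)%nat with (S (2 * n)) by lia. rewrite IB.
    rewrite S_INR, mult_INR, !S_INR. simpl (INR 0). field.
Qed.

(** * Damped integrals; the weight [w] will be [cos (tau * t)] or [sin (tau * t)] *)

Lemma continuous_damped (h w : R -> R) (sigma t : R) :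
  (forall x, continuous h x) -> (forall x, continuous w x) ->
  continuous (fun t => exp (- sigma * t) * w t * h t) t.
Proof.
intros Hh Hw.
apply (continuous_mult (K := R_AbsRing) (fun t => exp (- sigma * t) * w t) h); [ | apply Hh].
apply (continuous_mult (K := R_AbsRing) (fun t => exp (- sigma * t)) w); [ | apply Hw].
apply (ex_derive_continuous (V := R_NormedModule)). auto_derive. exact I.
Qed.

Lemma damped_le (h w : R -> R) (A C sigma t : R) :
  0 <= A -> (forall x, 0 <= x -> Rabs (h x) <= A * exp (C * x)) ->
  (forall x, Rabs (w x) <= 1) -> 0 <= t ->
  Rabs (exp (- sigma * t) * w t * h t) <= A * exp (- (sigma - C) * t).
Proof.
intros HA Hh Hw Ht.
rewrite !Rabs_mult, (Rabs_pos_eq (exp _)) by (left; apply exp_pos).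
replace (- (sigma - C) * t) with (- sigma * t + C * t) by ring.
rewrite exp_plus.
replace (A * (exp (- sigma * t) * exp (C * t)))
  with (exp (- sigma * t) * 1 * (A * exp (C * t))) by ring.
assert (He := exp_pos (- sigma * t)).
apply Rmult_le_compat; auto using Rabs_pos.
- apply Rmult_le_pos; [lra | apply Rabs_pos].
- apply Rmult_le_compat_l; [lra | apply Hw].
Qed.

Lemma is_lim_exp_neg (eps : R) :
  0 < eps -> is_lim (fun t => exp (- eps * t)) p_infty 0.
Proof.
intros He.
apply (is_lim_comp exp (fun t => - eps * t) p_infty 0 m_infty).
- apply is_lim_exp_m.
- intros P [M HM]. exists (- M / eps). intros t Ht. apply HM.
  apply (Rmult_lt_compat_l eps) in Ht; [ | exact He].
  replace (eps * (- M / eps)) with (- M) in Ht by (field; lra). lra.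
- exists 0. intros t _ H. discriminate H.
Qed.

Lemma is_lim_damped (h w : R -> R) (A C sigma : R) :
  0 <= A -> (forall x, 0 <= x -> Rabs (h x) <= A * exp (C * x)) ->
  (forall x, Rabs (w x) <= 1) -> C < sigma ->
  is_lim (fun t => exp (- sigma * t) * w t * h t) p_infty 0.
Proof.
intros HA Hh Hw HC.
assert (L : is_lim (fun t => A * exp (- (sigma - C) * t)) p_infty 0).
{ replace 0 with (A * 0) by ring.
  apply (is_lim_scal_l (fun t => exp (- (sigma - C) * t)) A p_infty 0).
  apply is_lim_exp_neg. lra. }
apply (is_lim_le_le_loc (fun t => - (A * exp (- (sigma - C) * t)))
         (fun t => A * exp (- (sigma - C) * t))).
- exists 0. intros t Ht. apply Rabs_le_between, damped_le; auto. lra.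
- replace (Finite 0) with (Rbar_opp 0) by (simpl; f_equal; ring).
  apply is_lim_opp, L.
- exact L.
Qed.

Lemma is_lim_RInt_damped (h w : R -> R) (A C sigma : R) :
  (forall x, continuous h x) -> (forall x, continuous w x) ->
  0 <= A -> (forall x, 0 <= x -> Rabs (h x) <= A * exp (C * x)) ->
  (forall x, Rabs (w x) <= 1) -> C < sigma ->
  is_lim (RInt (fun t => exp (- sigma * t) * w t * h t) 0) p_infty
    (real (Lim (RInt (fun t => exp (- sigma * t) * w t * h t) 0) p_infty)) /\
  Rabs (real (Lim (RInt (fun t => exp (- sigma * t) * w t * h t) 0) p_infty))
    <= A / (sigma - C).
Proof.
intros Hch Hcw HA Hh Hw HC.
destruct (is_lim_RInt_dominated (fun t => exp (- sigma * t) * w t * h t) A (sigma - C))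
  as [l [Hl Hb]].
- intros t. apply continuous_damped; assumption.
- lra.
- exact HA.
- intros t Ht. apply damped_le; assumption.
- rewrite (is_lim_unique _ _ _ Hl). split; assumption.
Qed.

(** Applied to a damped product [u], this is integration by parts with vanishing boundary term at
    infinity. *)
Lemma is_lim_RInt_derive (u du : R -> R) :
  (forall x, is_derive u x (du x)) -> (forall x, continuous du x) ->
  is_lim u p_infty 0 -> is_lim (RInt du 0) p_infty (- u 0).
Proof.
intros Hu Hc Hl.
apply (is_lim_ext (fun T => u T - u 0)).
- intros T. symmetry. apply is_RInt_unique. apply (is_RInt_derive u); auto.
- replace (- u 0) with (0 - u 0) by ring.
  apply is_lim_minus'; [exact Hl | apply is_lim_const].
Qed.

Lemma is_lim_RInt_lincomb (p q r : R -> R) (lp lq lr x y : R) :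
  (forall t, continuous p t) -> (forall t, continuous q t) -> (forall t, continuous r t) ->
  is_lim (RInt p 0) p_infty lp -> is_lim (RInt q 0) p_infty lq ->
  is_lim (RInt r 0) p_infty lr ->
  is_lim (RInt (fun t => p t + (x * q t + y * r t)) 0) p_infty (lp + (x * lq + y * lr)).
Proof.
intros Cp Cq Cr Hp Hq Hr.
assert (Hex : forall f : R -> R, (forall t, continuous f t) -> forall T, is_RInt f 0 T (RInt f 0 T)).
{ intros f Hf T. apply (RInt_correct (V := R_CompleteNormedModule)).
  apply (ex_RInt_continuous (V := R_CompleteNormedModule)). auto. }
apply (is_lim_ext (fun T => RInt p 0 T + (x * RInt q 0 T + y * RInt r 0 T))).
- intros T. symmetry. apply is_RInt_unique.
  apply (is_RInt_plus p (fun t => x * q t + y * r t)); [apply Hex, Cp | ].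
  apply (is_RInt_plus (fun t => x * q t) (fun t => y * r t)).
  + apply (is_RInt_scal q). apply Hex, Cq.
  + apply (is_RInt_scal r). apply Hex, Cr.
- apply is_lim_plus'; [exact Hp | ].
  apply is_lim_plus'.
  + apply (is_lim_scal_l (RInt q 0) x p_infty lq Hq).
  + apply (is_lim_scal_l (RInt r 0) y p_infty lr Hr).
Qed.

(** * Laplace transforms and integration by parts *)

(** [Lim] is total, so these are the intended integrals only where convergence is known, as in
    [Lcos_correct] and [Lsin_correct]. *)
Definition Lcos (h : R -> R) (sigma tau : R) : R :=
  real (Lim (RInt (fun t => exp (- sigma * t) * cos (tau * t) * h t) 0) p_infty).
Definition Lsin (h : R -> R) (sigma tau : R) : R :=
  real (Lim (RInt (fun t => exp (- sigma * t) * sin (tau * t) * h t) 0) p_infty).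
Definition Laplace (h : R -> R) (lam : C) : C :=
  (Lcos h (Re lam) (Im lam), - Lsin h (Re lam) (Im lam)).

Lemma continuous_cos_scal (tau x : R) : continuous (fun t => cos (tau * t)) x.
Proof.
apply (ex_derive_continuous (V := R_NormedModule)). auto_derive. exact I.
Qed.

Lemma continuous_sin_scal (tau x : R) : continuous (fun t => sin (tau * t)) x.
Proof.
apply (ex_derive_continuous (V := R_NormedModule)). auto_derive. exact I.
Qed.

Lemma Rabs_cos_le_1 (x : R) : Rabs (cos x) <= 1.
Proof. apply Rabs_le, COS_bound. Qed.

Lemma Rabs_sin_le_1 (x : R) : Rabs (sin x) <= 1.
Proof. apply Rabs_le, SIN_bound. Qed.

Lemma Cmod_le_Rabs_plus (x y : R) : Cmod (x, y) <= Rabs x + Rabs y.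
Proof.
unfold Cmod; simpl fst; simpl snd.
assert (Hx := Rabs_pos x). assert (Hy := Rabs_pos y).
rewrite <- (sqrt_pow2 (Rabs x + Rabs y)) by lra.
apply sqrt_le_1_alt.
rewrite <- (pow2_abs x), <- (pow2_abs y). nra.
Qed.

Section LaplaceExpBounded.

Variables (h : R -> R) (A C0 : R) (lam : C).
Hypothesis h_cont : forall x, continuous h x.
Hypothesis A_ge0 : 0 <= A.
Hypothesis h_le : forall x, 0 <= x -> Rabs (h x) <= A * exp (C0 * x).
Hypothesis lam_gt : C0 < Re lam.

Lemma Lcos_correct :
  is_lim (RInt (fun t => exp (- Re lam * t) * cos (Im lam * t) * h t) 0) p_infty
    (Lcos h (Re lam) (Im lam)) /\
  Rabs (Lcos h (Re lam) (Im lam)) <= A / (Re lam - C0).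
Proof.
apply (is_lim_RInt_damped h (fun t => cos (Im lam * t)) A C0);
  auto using continuous_cos_scal, Rabs_cos_le_1.
Qed.

Lemma Lsin_correct :
  is_lim (RInt (fun t => exp (- Re lam * t) * sin (Im lam * t) * h t) 0) p_infty
    (Lsin h (Re lam) (Im lam)) /\
  Rabs (Lsin h (Re lam) (Im lam)) <= A / (Re lam - C0).
Proof.
apply (is_lim_RInt_damped h (fun t => sin (Im lam * t)) A C0);
  auto using continuous_sin_scal, Rabs_sin_le_1.
Qed.

Lemma Laplace_correct : is_Laplace h lam (Laplace h lam).
Proof.
unfold is_Laplace, Laplace.
apply (is_RInt_gen_ext (V := prod_NormedModule R_AbsRing R_NormedModule R_NormedModule)
  (fun t => (exp (- Re lam * t) * cos (Im lam * t) * h t,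
             -1 * (exp (- Re lam * t) * sin (Im lam * t) * h t)))).
{ apply filter_forall. intros _ x _. unfold cexp_neg, Cmult, RtoC; simpl.
  apply injective_projections; simpl; ring. }
apply is_RInt_gen_pair_p_infty.
- intros t. apply continuous_damped; auto using continuous_cos_scal.
- intros t. apply (continuous_scal_r (K := R_AbsRing) (V := R_NormedModule) (-1)).
  apply continuous_damped; auto using continuous_sin_scal.
- apply Lcos_correct.
- apply (is_lim_ext (fun T => -1 *
    RInt (fun t => exp (- Re lam * t) * sin (Im lam * t) * h t) 0 T)).
  + intros T. symmetry. apply is_RInt_unique.
    apply (is_RInt_scal (fun t => exp (- Re lam * t) * sin (Im lam * t) * h t)).
    apply (RInt_correct (V := R_CompleteNormedModule)).
    apply (ex_RInt_continuous (V := R_CompleteNormedModule)).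
    intros t _. apply continuous_damped; auto using continuous_sin_scal.
  + replace (- Lsin h (Re lam) (Im lam)) with (-1 * Lsin h (Re lam) (Im lam)) by ring.
    apply (is_lim_scal_l _ (-1) p_infty (Lsin h (Re lam) (Im lam))), Lsin_correct.
Qed.

(** The factor 2 comes from bounding the modulus by the sum of the absolute values of the two
    components. *)
Lemma Cmod_Laplace_le : Cmod (Laplace h lam) <= 2 * A / (Re lam - C0).
Proof.
eapply Rle_trans; [apply Cmod_le_Rabs_plus | ].
rewrite Rabs_Ropp.
replace (2 * A / (Re lam - C0)) with (A / (Re lam - C0) + A / (Re lam - C0)) by (field; lra).
apply Rplus_le_compat; [apply Lcos_correct | apply Lsin_correct].
Qed.

End LaplaceExpBounded.

(** Integration by parts, carried out on the real integrals with cosine and sine and then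
    reassembled. *)
Lemma Laplace_derive (h dh : R -> R) (A C0 : R) (lam : C) :
  (forall x, is_derive h x (dh x)) -> (forall x, continuous dh x) -> 0 <= A ->
  (forall x, 0 <= x -> Rabs (h x) <= A * exp (C0 * x)) ->
  (forall x, 0 <= x -> Rabs (dh x) <= A * exp (C0 * x)) ->
  C0 < Re lam ->
  Cmult lam (Laplace h lam) = Cplus (RtoC (h 0)) (Laplace dh lam).
Proof.
intros Hd Cd HA Hh Hdh HC.
assert (Ch : forall x, continuous h x).
{ intros x. apply (ex_derive_continuous (V := R_NormedModule)). eexists. apply Hd. }
assert (Kc := proj1 (Lcos_correct h A C0 lam Ch HA Hh HC)).
assert (Ks := proj1 (Lsin_correct h A C0 lam Ch HA Hh HC)).
assert (Kc' := proj1 (Lcos_correct dh A C0 lam Cd HA Hdh HC)).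
assert (Ks' := proj1 (Lsin_correct dh A C0 lam Cd HA Hdh HC)).
unfold Laplace.
set (sigma := Re lam) in *. set (tau := Im lam) in *.
assert (cc : forall k : R -> R, (forall x, continuous k x) -> forall t,
  continuous (fun t => exp (- sigma * t) * cos (tau * t) * k t) t).
{ intros k Hk t. apply continuous_damped; auto using continuous_cos_scal. }
assert (cs : forall k : R -> R, (forall x, continuous k x) -> forall t,
  continuous (fun t => exp (- sigma * t) * sin (tau * t) * k t) t).
{ intros k Hk t. apply continuous_damped; auto using continuous_sin_scal. }
assert (clin : forall (p q r : R -> R) (x y : R), (forall t, continuous p t) ->
  (forall t, continuous q t) -> (forall t, continuous r t) ->
  forall t, continuous (fun t => p t + (x * q t + y * r t)) t).
{ intros p q r x y Hp Hq Hr t.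
  apply (continuous_plus p (fun t => x * q t + y * r t)); [apply Hp | ].
  apply (continuous_plus (fun t => x * q t) (fun t => y * r t)).
  - apply (continuous_scal_r (K := R_AbsRing) (V := R_NormedModule) x). apply Hq.
  - apply (continuous_scal_r (K := R_AbsRing) (V := R_NormedModule) y). apply Hr. }
(* The combination [x * p + y * q] is the part of the derivative of [exp (- sigma t) * w * h] in
   which [h] is not differentiated. The integral of the whole derivative tends both to [l] and to
   minus the value of the product at 0. *)
assert (parts : forall (w p q : R -> R) (x y l : R),
  (forall t, continuous p t) -> (forall t, continuous q t) ->
  (forall t, Rabs (w t) <= 1) ->
  (forall t, is_derive (fun t => exp (- sigma * t) * w t * h t) t
     (exp (- sigma * t) * w t * dh t + (x * p t + y * q t))) ->
  (forall t, continuous (fun t => exp (- sigma * t) * w t * dh t) t) ->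
  is_lim (RInt (fun t => exp (- sigma * t) * w t * dh t + (x * p t + y * q t)) 0)
    p_infty l ->
  - (w 0 * h 0) = l).
{ intros w p q x y l Hp Hq Hw Hder Cw Hl.
  assert (L := is_lim_RInt_derive _ _ Hder (clin _ _ _ x y Cw Hp Hq)
    (is_lim_damped h w A C0 sigma HA Hh Hw HC)).
  assert (E := eq_trans (eq_sym (is_lim_unique _ _ _ Hl)) (is_lim_unique _ _ _ L)).
  injection E as E. rewrite E, Rmult_0_r, exp_0. ring. }
assert (E1 : - (cos (tau * 0) * h 0) = Lcos dh sigma tau
    + (- sigma * Lcos h sigma tau + - tau * Lsin h sigma tau)).
{ apply (parts (fun t => cos (tau * t)) _ _ (- sigma) (- tau) _ (cc h Ch) (cs h Ch));
    [intros; apply Rabs_cos_le_1 | | apply cc, Cd | ].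
  - intros t. auto_derive; [repeat split; eexists; apply Hd | ].
    replace (Derive (fun x => h x) t) with (dh t)
      by (symmetry; exact (is_derive_unique _ _ _ (Hd t))).
    ring.
  - apply (is_lim_RInt_lincomb _ _ _ _ _ _ _ _ (cc dh Cd) (cc h Ch) (cs h Ch) Kc' Kc Ks). }
assert (E2 : - (sin (tau * 0) * h 0) = Lsin dh sigma tau
    + (- sigma * Lsin h sigma tau + tau * Lcos h sigma tau)).
{ apply (parts (fun t => sin (tau * t)) _ _ (- sigma) tau _ (cs h Ch) (cc h Ch));
    [intros; apply Rabs_sin_le_1 | | apply cs, Cd | ].
  - intros t. auto_derive; [repeat split; eexists; apply Hd | ].
    replace (Derive (fun x => h x) t) with (dh t)
      by (symmetry; exact (is_derive_unique _ _ _ (Hd t))).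
    ring.
  - apply (is_lim_RInt_lincomb _ _ _ _ _ _ _ _ (cs dh Cd) (cs h Ch) (cc h Ch) Ks' Ks Kc). }
(* [E1] and [E2] are now the real and imaginary parts of the claim. *)
rewrite Rmult_0_r, cos_0 in E1. rewrite Rmult_0_r, sin_0 in E2.
unfold Cmult, Cplus, RtoC; apply injective_projections; cbn [fst snd];
  fold (Re lam) (Im lam); fold sigma tau; lra.
Qed.

(** * The expansion with its exact remainder *)

Lemma Laplace_Weber_expansion (a sg A C0 : R) (g : R -> R) (lam : C) (N : nat) :
  Weber_eq a g -> g 0 = W0 a -> Derive g 0 = sg * W0' a -> 0 <= A ->
  (forall n, (n <= 2 * N + 2)%nat -> forall t, 0 <= t ->
     Rabs (Derive_n g n t) <= A * exp (C0 * t)) ->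
  C0 < Re lam -> lam <> RtoC 0 ->
  Cminus (Laplace g lam) (trunc_exp a sg N lam)
  = Cdiv (Laplace (Derive_n g (2 * N + 2)) lam) (Cpow lam (2 * N + 2)).
Proof.
intros Hg G0 G1 HA Hb HC Hlam.
assert (step : forall n, (n <= 2 * N + 1)%nat ->
  Laplace (Derive_n g n) lam
  = Cdiv (Cplus (RtoC (Derive_n g n 0)) (Laplace (Derive_n g (S n)) lam)) lam).
{ intros n Hn.
  rewrite <- (Laplace_derive (Derive_n g n) (Derive_n g (S n)) A C0 lam).
  - field. exact Hlam.
  - intros x. apply (Weber_eq_is_derive_n a g n x Hg).
  - intros x. apply (ex_derive_continuous (V := R_NormedModule)).
    eexists. apply (Weber_eq_is_derive_n a g (S n) x Hg).
  - exact HA.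
  - apply Hb. lia.
  - apply Hb. lia.
  - exact HC. }
(* Two integrations by parts produce one [alpha] term and one [beta] term, which matches the pairing
   of the two sums in [trunc_exp]. *)
assert (two : forall s, (s <= N)%nat ->
  Laplace (Derive_n g (2 * s)) lam
  = Cplus (Cplus (Cdiv (RtoC (alpha a s * W0 a)) lam)
                 (Cdiv (RtoC (beta a s * (sg * W0' a))) (Cmult lam lam)))
          (Cdiv (Laplace (Derive_n g (2 * s + 2)) lam) (Cmult lam lam))).
{ intros s Hs.
  destruct (Weber_eq_Derive_n_0 a g s Hg) as [Ea Eb].
  rewrite (step (2 * s)%nat), (step (S (2 * s))) by lia.
  rewrite Ea, Eb, G0, G1. replace (2 * s + 2)%nat with (S (S (2 * s))) by lia.
  field. exact Hlam. }
unfold trunc_exp.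
assert (Hpow : forall n, Cpow lam n <> RtoC 0) by (intros n; apply Cpow_nz, Hlam).
(* Induction on the truncation index: [two] at [s + 1] splits the remainder left at [s]. *)
assert (H : forall s, (s <= N)%nat ->
  Laplace g lam = Cplus (Cplus
    (Cmult (Cdiv (RtoC (W0 a)) lam)
       (sum_n (fun s => Cdiv (RtoC (alpha a s)) (Cpow lam (2 * s))) s))
    (Cmult (Cdiv (RtoC (sg * W0' a)) (Cpow lam 2))
       (sum_n (fun s => Cdiv (RtoC (beta a s)) (Cpow lam (2 * s))) s)))
    (Cdiv (Laplace (Derive_n g (2 * s + 2)) lam) (Cpow lam (2 * s + 2)))).
{ induction s as [|s IH]; intros Hs.
  - rewrite !sum_O. change (Laplace g lam) with (Laplace (Derive_n g (2 * 0)) lam).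
    rewrite (two 0%nat Hs). rewrite !RtoC_mult. simpl (2 * 0 + 2)%nat. simpl (2 * 0)%nat.
    simpl Cpow. field. exact Hlam.
  - rewrite IH by lia.
    assert (Csum : forall u : nat -> C, sum_n u (S s) = Cplus (sum_n u s) (u (S s)))
      by (intros u; exact (sum_Sn u s)).
    rewrite !Csum.
    replace (2 * s + 2)%nat with (2 * S s)%nat by lia.
    rewrite (two (S s) Hs).
    rewrite !RtoC_mult, (Cpow_add_r lam (2 * S s) 2). simpl (Cpow lam 2).
    specialize (Hpow (2 * S s)%nat).
    field. split; assumption. }
rewrite (H N (le_n N)). ring.
Qed.

(** * The sector and the final estimate *)

(** Monotonicity of [tan] turns the angle condition into a bound on [|Im lam| / Re lam]. The
    absolute value around [tan] makes the constant at least 1 for every [delta]. *)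
Lemma in_sector_Cmod_le (delta : R) (lam : C) :
  0 < delta -> in_sector delta lam ->
  Cmod lam <= (1 + Rabs (tan (PI / 2 - delta))) * Re lam.
Proof.
intros Hd [Hre Hat].
assert (Hs := Rabs_pos (atan (Im lam / Re lam))).
assert (HPI := PI_RGT_0).
assert (Htan : forall x, 0 <= x <= PI / 2 - delta -> tan x <= Rabs (tan (PI / 2 - delta))).
{ intros x Hx. apply Rle_trans with (tan (PI / 2 - delta)); [ | apply Rle_abs].
  destruct (Rle_lt_or_eq_dec x (PI / 2 - delta)) as [H | ->]; [lra | | lra].
  left. apply tan_increasing; lra. }
assert (Hq : Rabs (Im lam / Re lam) <= Rabs (tan (PI / 2 - delta))).
{ rewrite <- (tan_atan (Im lam / Re lam)) at 1.
  destruct (Rle_lt_dec 0 (atan (Im lam / Re lam))) as [H | H].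
  - rewrite (Rabs_pos_eq (atan _)) in Hat by exact H.
    rewrite Rabs_pos_eq; [apply Htan; lra | ].
    rewrite <- tan_0. destruct H as [H | <-]; [left; apply tan_increasing; lra | lra].
  - rewrite (Rabs_left (atan _)) in Hat by exact H.
    rewrite <- Rabs_Ropp, <- tan_neg.
    rewrite Rabs_pos_eq; [apply Htan; lra | ].
    rewrite <- tan_0. left. apply tan_increasing; lra. }
rewrite (surjective_pairing lam) at 1.
eapply Rle_trans; [apply Cmod_le_Rabs_plus | ].
change (fst lam) with (Re lam). change (snd lam) with (Im lam).
rewrite (Rabs_pos_eq (Re lam)) by lra.
unfold Rdiv in Hq. rewrite Rabs_mult, Rabs_inv, (Rabs_pos_eq (Re lam)) in Hq by lra.
assert (Rabs (Im lam) <= Rabs (tan (PI / 2 - delta)) * Re lam); [ | lra].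
apply (Rmult_le_reg_r (/ Re lam)); [apply Rinv_0_lt_compat, Hre | ].
rewrite Rmult_assoc, Rinv_r by lra. lra.
Qed.

(** The power [2 * N + 3] is that of the first omitted term, so these bounds for all [N] express the
    asymptotic expansion. *)
Theorem theorem4p1 :
  forall (a delta : R), 0 < delta ->
  forall (f : R -> R), is_Weber_W a f ->
  forall (sg : R), sg = 1 \/ sg = -1 ->
  forall (N : nat),
  exists (K R0 : R), 0 < R0 /\
    forall lam : C, in_sector delta lam -> R0 <= Cmod lam ->
      exists L : C, is_Laplace (fun t => f (sg * t)) lam L /\
        Cmod (Cminus L (trunc_exp a sg N lam)) <= K / Cmod lam ^ (2 * N + 3).
Proof.
intros a delta Hdelta f [Hf1 [Hf2 [F0 F1]]] sg Hsg N.
destruct (Weber_eq_reflect a sg f Hsg (conj Hf1 Hf2)) as [Hg G1].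
rewrite F1 in G1.
set (g := fun t => f (sg * t)) in *.
assert (G0 : g 0 = W0 a) by (unfold g; rewrite Rmult_0_r; exact F0).
destruct (exp_bounded_family (Derive_n g) (2 * N + 2)
  (fun n => Weber_eq_Derive_n_exp_bounded a g n Hg)) as [A [C0 [HA Hb]]].
set (k := 1 + Rabs (tan (PI / 2 - delta))).
assert (Hk : 1 <= k) by (unfold k; assert (H := Rabs_pos (tan (PI / 2 - delta))); lra).
assert (HC0 := Rabs_pos C0). assert (HC0' := Rle_abs C0).
assert (cont : forall n x, continuous (Derive_n g n) x).
{ intros n x. apply (ex_derive_continuous (V := R_NormedModule)).
  eexists. apply (Weber_eq_is_derive_n a g n x Hg). }
(* In the sector [Re lam >= |lam| / k], and beyond this radius [C0 <= |lam| / (2k)]; so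
   [Re lam - C0 >= |lam| / (2k)] and [2A / (Re lam - C0) <= 4Ak / |lam|]. Adding 1 keeps the radius
   positive. *)
exists (4 * A * k), (2 * k * Rabs C0 + 1). split; [nra | ].
intros lam Hsec HR.
assert (Hre := in_sector_Cmod_le delta lam Hdelta Hsec). fold k in Hre.
assert (Hm : 0 < Cmod lam) by nra.
assert (HC : Cmod lam / (2 * k) <= Re lam - C0).
{ apply (Rmult_le_reg_r (2 * k)); [lra | ].
  replace (Cmod lam / (2 * k) * (2 * k)) with (Cmod lam) by (field; lra). nra. }
assert (Hq : 0 < Cmod lam / (2 * k)) by (apply Rdiv_lt_0_compat; lra).
assert (Hlam : lam <> RtoC 0) by (intros ->; rewrite Cmod_0 in Hm; lra).
exists (Laplace g lam). split.
- apply (Laplace_correct g A C0 lam (cont 0%nat) HA); [ | lra].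
  apply (Hb 0%nat). lia.
- rewrite (Laplace_Weber_expansion a sg A C0 g lam N) by (assumption || lra).
  rewrite Cmod_div by (apply Cpow_nz, Hlam). rewrite Cmod_pow.
  replace (2 * N + 3)%nat with (S (2 * N + 2)) by lia.
  assert (Hp := pow_lt _ (2 * N + 2) Hm).
  apply Rle_trans with ((4 * A * k / Cmod lam) / Cmod lam ^ (2 * N + 2)).
  + apply Rmult_le_compat_r; [left; apply Rinv_0_lt_compat, Hp | ].
    eapply Rle_trans.
    * apply (Cmod_Laplace_le _ A C0 lam (cont _) HA); [ | lra]. apply Hb. lia.
    * replace (4 * A * k / Cmod lam) with (2 * A * / (Cmod lam / (2 * k))) by (field; lra).
      apply Rmult_le_compat_l; [lra | ]. apply Rinv_le_contravar; assumption.
  + right. rewrite <- tech_pow_Rmult. field. split; lra.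
Qed.
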